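(* Let $G$ be any undirected simple graph on $N=\{1,\dots,n\}$ and let $H$ be a forest on $N$. Then the vanishing ideal of $\mathcal M_1(G,H)$ is the square-free monomial ideal $$\mathcal I(\mathcal M_1(G,H))=\langle \sigma_{ij},\ \sigma_p \;:\; ij\notin E_H,\ p\text{ a path in }H\text{ with } e(p)\notin E_G\rangle.$$
   Context: A forest is a (not necessarily connected) graph with no cycles. $E_G$ denotes the edge set of $G$; $ij$ denotes an unordered pair of distinct vertices. $\mathrm{PD}_n$ is the set of real symmetric positive definite $n\times n$ matrices. $\mathcal M_1(G,H)$ is the set of $\Sigma\in\mathrm{PD}_n$ with all diagonal entries equal to $1$, $(\Sigma^{-1})_{ij}=0$ for all $i\ne j$ with $ij\notin E_G$, and $\Sigma_{kl}=0$ for all $k\ne l$ with $kl\notin E_H$. It is viewed inside the affine space of symmetric $n\times n$ matrices with ones on the diagonal, with coordinate ring $\mathbb R[\sigma_{ij}:i<j]$ (and $\sigma_{ji}=\sigma_{ij}$), and $\mathcal I(\mathcal M_1(G,H))$ is the ideal of all polynomials in this ring vanishing on $\mathcal M_1(G,H)$. A path $p$ traverses no vertex more than once and has two distinct endpoints; $e(p)=kl$ is its pair of endpoints and $\sigma_p=\prod_{ij\in p}\sigma_{ij}$ is the product of the variables corresponding to the edges of $p$. *)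

(* Defs.v *)
From HB Require Import structures.
From mathcomp Require Import all_boot all_order all_algebra.
From mathcomp Require Import reals.
From mathcomp Require Import mpoly.

Set Implicit Arguments.
Unset Strict Implicit.
Unset Printing Implicit Defensive.

Import Order.TTheory GRing.Theory Num.Theory.
Local Open Scope ring_scope.

Record sgraph (n : nat) := SGraph {
  adj :> rel 'I_n;
  adj_sym : ssrbool.symmetric adj;
  adj_irr : irreflexive adj
}.

(* [cycle] also accepts sequences of length 2 (an edge walked back and forth),
   whence the lower bound on the size. *)
Definition forest n (H : sgraph n) : Prop :=
  forall c : seq 'I_n, (2 < size c)%N -> uniq c -> ~~ cycle H c.

(* The vertices of a path are x :: p, its endpoints x and last x p; the latter
   are distinct because p is nonempty and x :: p is duplicate-free. *)
Definition graph_path n (H : sgraph n) (x : 'I_n) (p : seq 'I_n) : bool :=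
  [&& p != [::], uniq (x :: p) & path H x p].

Definition posdefmx (R : realType) n (S : 'M[R]_n) : Prop :=
  S^T = S /\ forall x : 'cV[R]_n, x != 0 -> 0 < (x^T *m S *m x) 0 0.

Definition M1 (R : realType) n (G H : sgraph n) (S : 'M[R]_n) : Prop :=
  [/\ posdefmx S,
      forall i, S i i = 1,
      forall i j, i != j -> ~~ G i j -> invmx S i j = 0
    & forall k l, k != l -> ~~ H k l -> S k l = 0].

(* The variables of the coordinate ring are indexed by the pairs i < j. *)
Definition opair (n : nat) := {e : 'I_n * 'I_n | (e.1 < e.2)%N}.

Definition nvars (n : nat) : nat := #|{: opair n}|.

Notation coordring R n := {mpoly R[nvars n]}.

(* Entry (i, j) of the generic symmetric matrix with unit diagonal: the
   variable of the unordered pair ij if i != j, and 1 if i = j. *)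
Definition sigma (R : realType) n (i j : 'I_n) : coordring R n :=
  if (insub (i, j) : option (opair n)) is Some e then 'X_(enum_rank e)
  else if (insub (j, i) : option (opair n)) is Some e then 'X_(enum_rank e)
  else 1.

Definition sigma_path (R : realType) n (x : 'I_n) (p : seq 'I_n) :
    coordring R n :=
  \prod_(e <- zip (x :: p) p) sigma R e.1 e.2.

Definition coords (R : realType) n (S : 'M[R]_n) : 'I_(nvars n) -> R :=
  fun k => S (val (enum_val k)).1 (val (enum_val k)).2.

Definition vanishing_ideal (R : realType) n (X : 'M[R]_n -> Prop)
    (f : coordring R n) : Prop :=
  forall S, X S -> f.@[coords S] = 0.

Definition ideal_gen (A : comNzRingType) (E : A -> Prop) (f : A) : Prop :=
  exists s : seq (A * A),
    (forall t, t \in s -> E t.2) /\ f = \sum_(t <- s) t.1 * t.2.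

Definition squarefree_monomial (R : realType) k (f : {mpoly R[k]}) : Prop :=
  exists m : 'X_{1..k}, (forall i, (m i <= 1)%N) /\ f = 'X_[m].

Definition squarefree_monomial_ideal (R : realType) k
    (I : {mpoly R[k]} -> Prop) : Prop :=
  exists E : {mpoly R[k]} -> Prop,
    (forall g, E g -> squarefree_monomial g) /\
    (forall f, I f <-> ideal_gen E f).

Inductive path_generator (R : realType) n (G H : sgraph n) :
    coordring R n -> Prop :=
| NonEdgeGenerator i j of i != j & ~~ H i j :
    path_generator G H (sigma R i j)
| PathGenerator x p of graph_path H x p & ~~ G x (last x p) :
    path_generator G H (sigma_path R x p).

(* Main.v *)
(** For a positive definite S supported on the forest H, the entry (k, l) of
    S^-1 vanishes if and only if k and l are not joined by a path of H on which
    all the entries of S are nonzero.  Hence M1 is the intersection of the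
    positive definite cone with the zero locus of the square-free monomials
    generating the ideal.  That locus is a union of coordinate subspaces, and
    all sufficiently small points of it are positive definite, so a polynomial
    vanishing on M1 vanishes identically on each of these subspaces; this
    forces each of its monomials to be divisible by a generator. *)

Require Import Defs.
From mathcomp Require Import all_boot all_order all_algebra.
From mathcomp Require Import reals.
From mathcomp Require Import mpoly.
From mathcomp Require Import ring lra.
From Stdlib Require Import Classical.

Set Implicit Arguments.
Unset Strict Implicit.
Unset Printing Implicit Defensive.

Import Order.TTheory GRing.Theory Num.Theory.
Local Open Scope ring_scope.

(** * Positive definite matrices *)

Lemma posdefmx_unit (R : realType) n (S : 'M[R]_n) : posdefmx S -> S \in unitmx.
Proof.
move=> [symS posS]; rewrite unitmxE unitfE; apply/det0P => -[v v0 vS].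
have /posS : v^T != 0 by rewrite -(inj_eq (@trmx_inj _ _ _)) trmxK trmx0.
by rewrite trmxK vS mul0mx mxE ltxx.
Qed.

Lemma quad_formE (R : realType) n (S : 'M[R]_n) (x : 'cV[R]_n) :
  (x^T *m S *m x) 0 0 = \sum_i x i 0 * (S *m x) i 0.
Proof. by rewrite -mulmxA mxE; apply: eq_bigr => i _; rewrite mxE. Qed.

(** Diagonal dominance: since [2|ab| <= a^2 + b^2], the form is at least [1 - n/(n+1)] times the sum
    of squares of [x]. *)
Lemma posdefmx_small (R : realType) n (S : 'M[R]_n) :
  S^T = S -> (forall i, S i i = 1) ->
  (forall i j, i != j -> `|S i j| <= n.+1%:R^-1) -> posdefmx S.
Proof.
move=> symS diagS smallS; split=> // x x0.
set e : R := n.+1%:R^-1 in smallS.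
pose q := \sum_i x i 0 ^+ 2.
have q_gt0 : 0 < q.
  rewrite lt_def sumr_ge0 ?andbT => [|i _]; last exact: sqr_ge0.
  apply: contra x0 => /eqP /psumr_eq0P xi0; apply/eqP/colP => i; rewrite mxE.
  by apply/eqP; rewrite -sqrf_eq0 xi0 // => j _; exact: sqr_ge0.
have e_gt0 : 0 < e by rewrite invr_gt0.
(* The loss is charged to the diagonal terms too, so that the double sum is exactly [q - e n q]. *)
have term i j : x i 0 * (S i j * x j 0) >=
    (i == j)%:R * x i 0 ^+ 2 - e / 2 * (x i 0 ^+ 2 + x j 0 ^+ 2).
  have [->|/smallS] := eqVneq i j.
    by rewrite diagS /= mul1r; have := sqr_ge0 (x j 0); nra.
  rewrite ler_norml => /andP[Sl Sr].
  have := sqr_ge0 (x i 0 - x j 0); have := sqr_ge0 (x i 0 + x j 0).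
  rewrite /= mul0r; nra.
have sum_term : \sum_i \sum_j ((i == j)%:R * x i 0 ^+ 2 -
    e / 2 * (x i 0 ^+ 2 + x j 0 ^+ 2)) = q - e * n%:R * q.
  under eq_bigr => i _.
    rewrite sumrB (bigD1 i) //= eqxx mul1r big1 ?addr0; last first.
      by move=> j /negPf; rewrite eq_sym => ->; rewrite mul0r.
    rewrite -mulr_sumr big_split /= sumr_const card_ord.
  over.
  rewrite sumrB -mulr_sumr big_split /= sumr_const card_ord sumrMnl -/q.
  by rewrite -mulr_natl; field.
rewrite quad_formE; apply: (@lt_le_trans _ _ (q - e * n%:R * q)); last first.
  rewrite -sum_term; apply: ler_sum => i _; rewrite mxE mulr_sumr.
  by apply: ler_sum => j _; exact: term.
have en : e * n%:R < 1.
  by rewrite /e mulrC ltr_pdivrMr // mul1r ltr_nat.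
by rewrite subr_gt0 gtr_pMl.
Qed.

(** * Inverses of matrices supported on a graph *)

(** A path from [x] to [y] avoiding the edge [xy] would have at least three vertices, and this edge
    would close it to a cycle. *)
Lemma forest_edge_bridge n (H : sgraph n) x y (e : rel 'I_n) :
  forest H -> H x y ->
  (forall i j, e i j = H i j && ((i, j) \notin [:: (x, y); (y, x)])) ->
  ~~ connect e x y.
Proof.
move=> forH Hxy eE; apply/negP => /connectP[p0 /shortenP[p ep up _] yE].
have eH : subrel e H by move=> i j; rewrite eE => /andP[].
have := forH (x :: p); case: p ep up yE => [|z [|w p]].
- by move=> _ _ yx; rewrite /= in yx; move: Hxy; rewrite yx adj_irr.
- by move=> /= + _ yz; rewrite eE -yz mem_head !andbF.
move=> ep up yE /(_ isT up) /negP[].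
by rewrite /cycle rcons_path (sub_path eH ep) -yE adj_sym.
Qed.

(* If the column v of S^-1 at l vanishes at the first vertex x of a path x, y, ...
   to l, then the restriction w of v to the component of x in H minus the edge xy
   satisfies w^T S w = 0; hence w = 0 and S x y * v y = 0.  Walking along the path
   would give v l = 0 if all edges had nonzero weight. *)
Lemma forest_inv_eq0 (R : realType) n (H : sgraph n) (S : 'M[R]_n) x p :
  forest H -> posdefmx S -> (forall i j, i != j -> ~~ H i j -> S i j = 0) ->
  graph_path H x p -> invmx S x (last x p) = 0 ->
  \prod_(d <- zip (x :: p) p) S d.1 d.2 = 0.
Proof.
move=> forH pdS suppS /and3P[_ up pp].
have [l lE] : {l | l = last x p} by exists (last x p).
rewrite -lE => inv0.
have Su := posdefmx_unit pdS; have [symS posS] := pdS.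
pose v := col l (invmx S).
have SvE i : (S *m v) i 0 = (i == l)%:R.
  by rewrite /v colE mulmxA mulmxV ?mul1mx // mxE eqxx andbT.
(* As [S v] is the unit vector at [l], the form at [v] equals the entry of [v] at [l]. *)
have vl : v l 0 != 0.
  have v0 : v != 0.
    apply/eqP => v0; have := SvE l; rewrite v0 mulmx0 eqxx mxE.
    by move=> /esym/eqP; rewrite oner_eq0.
  have := posS _ v0; rewrite quad_formE (bigD1 l) //= SvE eqxx mulr1 big1 ?addr0.
    by move=> /gt_eqF->.
  by move=> i /negPf il; rewrite SvE il mulr0.
have vx : v x 0 = 0 by rewrite mxE.
elim: p x {inv0} up pp lE vx => [|y p IH] x up pp lE vx; first by rewrite lE /= vx eqxx in vl.
rewrite /= big_cons /=; have [->|Sxy] := eqVneq (S x y) 0; first by rewrite mul0r.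
move: pp => /= /andP[Hxy pp]; move: up; rewrite cons_uniq => /andP[xp up].
rewrite IH ?mulr0 //.
pose e : rel 'I_n := [rel i j | H i j && ((i, j) \notin [:: (x, y); (y, x)])].
have connC : connect_sym e.
  apply: sym_connect_sym => i j; rewrite /e /= adj_sym !inE !xpair_eqE.
  by rewrite orbC [(i == y) && _]andbC [(i == x) && _]andbC.
have xy : ~~ connect e x y by apply: forest_edge_bridge Hxy _.
(* The rest of the path avoids [x], so it survives the deletion and puts [l] on the side of [y]. *)
have yl : connect e y l.
  apply/connectP; exists p => //.
  apply: (@sub_in_path _ (predC1 x) H) pp.
    move=> i j /= ix jx Hij; rewrite /e /= Hij !inE !xpair_eqE.
    by rewrite (negPf ix) (negPf jx) andbF.
  by apply/allP => z zp; apply: contraNneq xp => <-.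
(* Only the bridge [xy] can carry a nonzero entry of [S] out of the component of [x]. *)
have leaves i j : connect e x i -> ~~ connect e x j -> S i j != 0 ->
    i = x /\ j = y.
  move=> xi xj Sij; have ij : i != j by apply: contraNneq xj => <-.
  have Hij : H i j by apply: contraNT Sij => /(suppS _ _ ij)->.
  have : ~~ e i j by apply: contra xj => /connect1; apply: connect_trans.
  rewrite /e /= Hij /= negbK !inE !xpair_eqE => /orP[]/andP[/eqP iE /eqP jE] //.
  by rewrite iE (negPf xy) in xi.
pose w : 'cV[R]_n := \col_i ((connect e x i)%:R * v i 0).
(* [S v] vanishes on this component, which omits [l]; restricting [v] to it loses only the term
   across the bridge. *)
have Sw i : connect e x i -> (S *m w) i 0 = - ((i == x)%:R * S x y * v y 0).
  move=> xi; apply/eqP; rewrite -addr_eq0; apply/eqP.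
  have Svi : (S *m v) i 0 = 0.
    rewrite SvE; case: eqP => // il; case/negP: xy.
    by rewrite (connect_trans xi) // il connC.
  rewrite -[RHS]Svi !mxE (bigD1 y) //= [in RHS](bigD1 y) //= addrAC; congr (_ + _).
    rewrite [w _ _]mxE (negPf xy) mul0r mulr0 add0r.
    congr (_ * _); last by rewrite mxE.
    have [->|ix] := eqVneq i x; first by rewrite mul1r.
    have [->|/(leaves _ _ xi xy)[ixE _]] := eqVneq (S i y) 0;
      first by rewrite mul0r.
    by rewrite ixE eqxx in ix.
  apply: eq_bigr => j jy; rewrite [w _ _]mxE.
  case xj: (connect e x j); first by rewrite mul1r.
  have [->|/(leaves _ _ xi (negbT xj))[_ jyE]] := eqVneq (S i j) 0;
    first by rewrite !mul0r.
  by rewrite jyE eqxx in jy.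
have w0 : w = 0.
  apply/eqP/contraT => /posS; rewrite quad_formE big1 ?ltxx // => i _.
  rewrite mxE; case xi: (connect e x i); last by rewrite !mul0r.
  rewrite Sw //; have [->|_] := eqVneq i x; first by rewrite vx mulr0 mul0r.
  by rewrite !mul0r oppr0 mulr0.
have := Sw x (connect0 _ _); rewrite w0 mulmx0 mxE eqxx mul1r => /esym/eqP.
by rewrite oppr_eq0 mulf_eq0 (negPf Sxy) => /eqP.
Qed.

(* S commutes with the diagonal indicator D of the component of k, hence so does
   S^-1. *)
Lemma disconnected_inv_eq0 (R : realType) n (S : 'M[R]_n) k l :
  S \in unitmx -> S^T = S ->
  ~~ connect [rel i j | (i != j) && (S i j != 0)] k l -> invmx S k l = 0.
Proof.
move=> Su symS nkl; set e : rel 'I_n := [rel i j | _] in nkl.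
have connC : connect_sym e.
  by apply: sym_connect_sym => i j; rewrite /e /= eq_sym -[in LHS]symS mxE.
pose D : 'M[R]_n := diag_mx (\row_i (connect e k i)%:R).
have DS : D *m S = S *m D.
  apply/matrixP => i j; rewrite mul_diag_mx mul_mx_diag !mxE.
  have [->|ij] := eqVneq i j; first by rewrite mulrC.
  have [->|Sij] := eqVneq (S i j) 0; first by rewrite mulr0 mul0r.
  have eij : e i j by rewrite /e /= ij.
  by rewrite mulrC ![connect e k _]connC (same_connect connC (connect1 eij)).
have : D *m invmx S = invmx S *m D.
  by rewrite -[LHS](mulKmx Su) -[RHS](mulmxK Su) !mulmxA -(mulmxA _ S D) -DS !mulmxA.
move=> /matrixP/(_ k l); rewrite mul_diag_mx mul_mx_diag !mxE connect0 (negPf nkl).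
by rewrite mul1r mulr0.
Qed.

(** * Coefficients from values near the origin *)

(** Uniqueness of base [B] digits: reduction modulo [B] isolates the lowest digit, division by [B]
    leaves the others. *)
Lemma base_expansion_inj B n (a b : 'I_n -> nat) :
  (forall i, a i < B)%N -> (forall i, b i < B)%N ->
  (\sum_(i < n) a i * B ^ i = \sum_(i < n) b i * B ^ i)%N -> a =1 b.
Proof.
elim: n a b => [|n IH] a b aB bB; first by move=> _ [].
have shift (c : 'I_n.+1 -> nat) : (\sum_(i < n.+1) c i * B ^ i =
    (\sum_(i < n) c (lift ord0 i) * B ^ i) * B + c ord0)%N.
  rewrite big_ord_recl expn0 muln1 addnC big_distrl; congr (_ + _)%N.
  by apply: eq_bigr => i _; rewrite lift0 expnSr mulnA.
have B0 := leq_ltn_trans (leq0n _) (aB ord0).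
rewrite !shift => eqab.
have eq0 : a ord0 = b ord0.
  by have /(congr1 (modn^~ B)) := eqab; rewrite !modnMDl !modn_small.
have /IH eqS : (\sum_(i < n) a (lift ord0 i) * B ^ i =
    \sum_(i < n) b (lift ord0 i) * B ^ i)%N.
  by have /(congr1 (divn^~ B)) := eqab; rewrite !divnMDl // !divn_small ?addn0.
by move=> i; case: (unliftP ord0 i) => [j|] ->; rewrite ?eq0 ?eqS.
Qed.

(** The points [e / (i + 1)] with [i < size p] would be more distinct roots than the degree
    allows. *)
Lemma poly_eq0_interval (R : realType) (p : {poly R}) e :
  0 < e -> (forall t, 0 < t <= e -> p.[t] = 0) -> p = 0.
Proof.
move=> e0 pe; apply/eqP/contraT => p0.
pose r (i : nat) := e / i.+1%:R.
have := @max_poly_roots _ p [seq r i | i <- iota 0 (size p)] p0.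
rewrite size_map size_iota ltnn => -> //.
- apply/allP => _ /mapP[i _ ->]; apply/eqP/pe.
  by rewrite divr_gt0 // ler_pdivrMr // ler_peMr ?ler1n // ltW.
rewrite map_inj_uniq ?iota_uniq // => i j /(mulfI (lt0r_neq0 e0)) /invr_inj /eqP.
by rewrite eqr_nat eqSS => /eqP.
Qed.

(* Kronecker substitution: along the curve v_i = t^(B^i) with B larger than all
   exponents, distinct monomials become distinct powers of t. *)
Lemma mcoeff_eq0_box (R : realType) k (f : {mpoly R[k]}) (m : 'X_{1..k}) e :
  0 < e ->
  (forall v : 'I_k -> R, (forall i, `|v i| <= e) ->
     (forall i, m i = 0%N -> v i = 0) -> f.@[v] = 0) ->
  f@_m = 0.
Proof.
move=> e0 f0; have [mf|/memN_msupp_eq0//] := boolP (m \in msupp f).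
pose B := msize f.
pose wt (m' : 'X_{1..k}) := (\sum_(i < k) m' i * B ^ i)%N.
(* Monomials failing this test contain a variable absent from [m], hence vanish on the curve. *)
pose le_supp (m' : 'X_{1..k}) := [forall i, (m i == 0%N) ==> (m' i == 0%N)].
pose p : {poly R} := \sum_(m' <- msupp f | le_supp m') f@_m' *: 'X^(wt m').
have mB m' i : m' \in msupp f -> (m' i < B)%N.
  move=> /msize_mdeg_lt; apply: leq_ltn_trans.
  by rewrite mdegE (bigD1 i) //= leq_addr.
have B0 : (0 < B)%N.
  by apply: leq_ltn_trans (msize_mdeg_lt mf).
have p0 : p = 0.
  (* The bound [t <= 1] gives [t^(B^i) <= t <= e], which keeps the curve in the box. *)
  apply: (@poly_eq0_interval _ _ (Num.min e 1)); first by rewrite lt_min e0 ltr01.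
  move=> t /andP[t0]; rewrite le_min => /andP[te t1].
  pose v i := if m i == 0%N then 0 else t ^+ (B ^ i).
  rewrite -(f0 v) => [|i|i mi]; last by rewrite /v mi.
    rewrite mevalE horner_sum big_mkcond; apply: eq_bigr => m' _.
    case: ifPn => [/forallP m'm|].
      rewrite hornerZ hornerXn -prodrXr; congr (_ * _); apply: eq_bigr => i _.
      rewrite /v; have := m'm i; case: eqP => _ /=; last by rewrite mulnC exprM.
      by move=> /eqP->; rewrite mul0n !expr0.
    rewrite negb_forall => /existsP[i]; rewrite negb_imply => /andP[mi m'i].
    by rewrite (bigD1 i) //= /v mi expr0n (negPf m'i) mul0r mulr0.
  rewrite /v; case: ifP => _; first by rewrite normr0 ltW.
  rewrite ger0_norm ?exprn_ge0 ?(ltW t0) //; apply: le_trans te.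
  by apply: ler_iXnr => //; [rewrite expn_gt0 B0 | exact: ltW].
have := congr1 (fun q : {poly R} => q`_(wt m)) p0.
rewrite coef_sum coef0 big_mkcond (bigD1_seq m) ?msupp_uniq //=.
have -> : le_supp m by apply/forallP => i; apply/implyP.
rewrite coefZ coefXn eqxx mulr1 big_seq_cond big1 ?addr0 // => m' /andP[m'f mm'].
case: ifP => // _.
rewrite coefZ coefXn; case: eqP => [wm|]; last by rewrite mulr0.
case/eqP: mm'; apply/mnmP => i; move: i; apply: (@base_expansion_inj B) => //.
- by move=> i; exact: mB.
- by move=> i; exact: mB.
Qed.

(** * The generic matrix and its path monomials *)

Lemma sigma_var (R : realType) n (k : 'I_(nvars n)) :
  sigma R (val (enum_val k)).1 (val (enum_val k)).2 = 'X_k.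
Proof.
rewrite /sigma; case: insubP => [e _ eE|]; last by case: (enum_val k) => [[i j] /= ->].
by rewrite -(enum_valK k); congr 'X_(enum_rank _); apply/val_inj; rewrite eE; case: (val _).
Qed.

Lemma sigma_diag (R : realType) n (i : 'I_n) : sigma R i i = 1.
Proof. by rewrite /sigma !insubN ?ltnn. Qed.

Lemma sigmaC (R : realType) n (i j : 'I_n) : sigma R i j = sigma R j i.
Proof.
by rewrite /sigma; case: insubP => [e /= ij _|]; [rewrite insubN // -leqNgt ltnW|].
Qed.

Lemma sigma_neqP (R : realType) n (i j : 'I_n) : i != j ->
  exists2 k : 'I_(nvars n), sigma R i j = 'X_k &
    val (enum_val k) = (i, j) \/ val (enum_val k) = (j, i).
Proof.
wlog ij : i j / (i < j)%N.
  move=> W ij; have [lij|lji|/val_inj eij] := ltngtP i j.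
  - exact: W.
  - have [|k sk vk] := W j i lji; first by rewrite eq_sym.
    by exists k; rewrite 1?sigmaC //; case: vk; [right|left].
  - by rewrite eij eqxx in ij.
move=> _; pose e : opair n := exist _ (i, j) ij.
exists (enum_rank e); last by left; rewrite enum_rankK.
by rewrite -sigma_var enum_rankK.
Qed.

Lemma meval_sigma (R : realType) n (S : 'M[R]_n) i j :
  S^T = S -> (forall i, S i i = 1) -> (sigma R i j).@[coords S] = S i j.
Proof.
move=> symS diagS; have [->|/(sigma_neqP R)[k -> kE]] := eqVneq i j.
  by rewrite sigma_diag meval1 diagS.
rewrite mevalXU /coords; case: kE => -> //=.
by rewrite -[in LHS]symS mxE.
Qed.

(** The variable of the first edge involves [x], which the rest of the path avoids, so no exponent
    exceeds 1. The clause on endpoints carries this through the induction. *)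
Lemma sigma_pathX (R : realType) n (x : 'I_n) p : uniq (x :: p) ->
  exists2 m : 'X_{1..nvars n}, sigma_path R x p = 'X_[m] &
    forall k, (m k <= 1)%N /\
      (m k != 0%N ->
       (val (enum_val k)).1 \in x :: p /\ (val (enum_val k)).2 \in x :: p).
Proof.
elim: p x => [|y p IH] x.
  move=> _; exists 0%MM; first by rewrite /sigma_path big_nil mpolyX0.
  by move=> k; rewrite mnm0E.
rewrite cons_uniq => /andP[xp /IH[m pE mE]].
have /(sigma_neqP R)[k0 sE k0E] : x != y by apply: contraNneq xp => ->; rewrite mem_head.
exists (U_(k0) + m)%MM; first by rewrite mpolyXD -pE -sE /sigma_path /= big_cons.
move=> k; rewrite mnmDE mnm1E; have [m1 mp] := mE k.
have [<-|_] := eqVneq k0 k; last first.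
  by rewrite add0n; split=> // /mp[]; rewrite ![_ \in x :: _]inE => -> ->; rewrite !orbT.
have -> : m k0 = 0%N.
  apply/eqP/contraT; have [_ mp0] := mE k0 => /mp0.
  by case: k0E => -> /= [] + +; rewrite (negPf xp).
by split=> // _; case: k0E => -> /=; rewrite !inE !eqxx ?orbT.
Qed.

Lemma path_generator_squarefree (R : realType) n (G H : sgraph n) g :
  path_generator (R := R) G H g -> squarefree_monomial g.
Proof.
case=> [i j ij _|x p /and3P[_ up _] _].
  have [k -> _] := sigma_neqP R ij; exists U_(k)%MM; split=> // l.
  by rewrite mnm1E leq_b1.
by have [m mE m1] := sigma_pathX R up; exists m; split=> // k; case: (m1 k).
Qed.

(** * The two inclusions of ideals *)

Lemma ideal_gen0 (A : comNzRingType) (E : A -> Prop) : ideal_gen E 0.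
Proof. by exists [::]; rewrite big_nil. Qed.

Lemma ideal_genD (A : comNzRingType) (E : A -> Prop) f g :
  ideal_gen E f -> ideal_gen E g -> ideal_gen E (f + g).
Proof.
move=> [s [sE ->]] [t [tE ->]]; exists (s ++ t); rewrite big_cat; split=> // u.
by rewrite mem_cat => /orP[/sE|/tE].
Qed.

Lemma ideal_genM (A : comNzRingType) (E : A -> Prop) f g :
  E g -> ideal_gen E (f * g).
Proof.
by move=> Eg; exists [:: (f, g)]; rewrite big_seq1; split=> // t /[!inE] /eqP->.
Qed.

(** A right inverse of [coords], used to pass from points of the affine space to matrices. *)
Definition point_mx (R : realType) n (v : 'I_(nvars n) -> R) : 'M[R]_n :=
  \matrix_(i, j) (sigma R i j).@[v].

Lemma coords_point_mx (R : realType) n (v : 'I_(nvars n) -> R) :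
  coords (point_mx v) =1 v.
Proof. by move=> k; rewrite /coords mxE sigma_var mevalXU. Qed.

Lemma meval_sigma_path (R : realType) n (v : 'I_(nvars n) -> R) x p :
  (sigma_path R x p).@[v] =
  \prod_(d <- zip (x :: p) p) (sigma R d.1 d.2).@[v].
Proof. by rewrite /sigma_path rmorph_prod. Qed.

(** The inverse of [S] vanishes at the nonadjacent endpoints of the path; [forest_inv_eq0] turns
    this into vanishing of the path product. *)
Lemma path_generator_M1 (R : realType) n (G H : sgraph n) (S : 'M[R]_n) g :
  forest H -> M1 G H S -> path_generator G H g -> g.@[coords S] = 0.
Proof.
move=> forH [pdS diagS invS suppS] gG; have [symS _] := pdS.
case: gG => [i j ij Hij|x p Hp Gp]; first by rewrite meval_sigma // suppS.
rewrite meval_sigma_path; under eq_bigr do rewrite meval_sigma //.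
apply: (forest_inv_eq0 forH pdS suppS Hp); apply: invS => //.
by case/and3P: Hp; case: p {Gp} => // y p _ /= /andP[xp _] _;
  apply: contraNneq xp => ->; exact: mem_last.
Qed.

(** Smallness gives positive definiteness. A nonzero entry of the inverse needs a path of nonzero
    entries, which lies in [H]; its monomial is nonzero at [v], so its endpoints are adjacent in
    [G]. *)
Lemma M1_point_mx (R : realType) n (G H : sgraph n) (v : 'I_(nvars n) -> R) :
  (forall k, `|v k| <= n.+1%:R^-1) ->
  (forall g, path_generator G H g -> g.@[v] = 0) -> M1 G H (point_mx v).
Proof.
move=> vs gen0; set S := point_mx v.
have symS : S^T = S by apply/matrixP => i j; rewrite !mxE sigmaC.
have diagS i : S i i = 1 by rewrite mxE sigma_diag meval1.
have suppS i j : i != j -> ~~ H i j -> S i j = 0.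
  by move=> ij Hij; rewrite mxE; apply: gen0; exact: NonEdgeGenerator.
have pdS : posdefmx S.
  apply: posdefmx_small => // i j ij; rewrite mxE.
  by have [k -> _] := sigma_neqP R ij; rewrite mevalXU.
split=> // k l kl Gkl; apply: disconnected_inv_eq0 => //; first exact: posdefmx_unit.
apply/negP => /connectP[p0 /shortenP[p ep up _] lE].
have Hp : graph_path H k p.
  apply/and3P; split=> //; first by apply: contraNneq kl => p0E; rewrite lE p0E.
  apply: sub_path ep => i j /andP[ij]; apply: contraNT => Hij.
  by rewrite suppS.
have : (sigma_path R k p).@[v] = 0.
  by apply: gen0; apply: PathGenerator => //; rewrite -lE.
apply/eqP; rewrite meval_sigma_path.
elim: p k ep {up lE Hp kl Gkl} => [|y p IH] k /=; first by rewrite big_nil oner_neq0.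
move=> /andP[/andP[_ Sky] ep]; rewrite big_cons mulf_neq0 ?IH //=.
by rewrite mxE in Sky.
Qed.

(** Otherwise each generator contains a variable absent from [m], so all vanish on the coordinate
    subspace of [m]. Its small points then lie in [M1], and the coefficient of [m] in [f] is
    zero. *)
Lemma msupp_vanishing_ideal (R : realType) n (G H : sgraph n)
    (f : coordring R n) m :
  vanishing_ideal (M1 G H) f -> m \in msupp f ->
  exists2 g : 'X_{1..nvars n}, path_generator (R := R) G H 'X_[g] & (g <= m)%MM.
Proof.
move=> f0 mf; apply: NNPP => Nm; move: mf; rewrite mcoeff_msupp => /eqP[].
apply: (@mcoeff_eq0_box _ _ _ _ n.+1%:R^-1) => [|v vs vm]; first by rewrite invr_gt0.
rewrite -(meval_eq _ (coords_point_mx v)); apply: f0; apply: M1_point_mx vs _ => g gG.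
have [g' [sq gE]] := path_generator_squarefree gG; rewrite gE in gG *.
have /forallPn[k] : ~~ [forall k, g' k <= m k]%N.
  by apply/negP => /forallP gm; apply: Nm; exists g' => //; apply/mnm_lepP.
rewrite -ltnNge => mk.
(* Square-freeness enters here: [m k < g' k <= 1]. *)
have mk0 : m k = 0%N by apply/eqP; rewrite -leqn0 -ltnS (leq_trans mk).
by rewrite mevalX (bigD1 k) //= vm // expr0n -leqn0 leqNgt (leq_ltn_trans _ mk) // mul0r.
Qed.

Theorem theorem4 (R : realType) (n : nat) (G H : sgraph n) :
  forest H ->
  (forall f : coordring R n,
     vanishing_ideal (M1 (R := R) G H) f <->
     ideal_gen (path_generator (R := R) G H) f) /\
  squarefree_monomial_ideal (vanishing_ideal (M1 (R := R) G H)).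
Proof.
move=> forH.
have idealP (f : coordring R n) : vanishing_ideal (M1 (R := R) G H) f <->
    ideal_gen (path_generator (R := R) G H) f.
  split=> [f0|[s [sE ->]] S MS]; last first.
    rewrite raddf_sum big_seq big1 // => t /sE tG.
    by rewrite /= mevalM (path_generator_M1 forH MS tG) mulr0.
  (* The terms of [f] are treated one by one, each being a multiple of a generator. *)
  rewrite (mpolyE f) big_seq.
  apply: big_ind => [||m mf]; [exact: ideal_gen0 | exact: ideal_genD |].
  have [g gG gm] := msupp_vanishing_ideal f0 mf.
  by rewrite -(submK gm) mpolyXD scalerAl; exact: ideal_genM.
split=> //; exists (path_generator (R := R) G H); split=> // g.
exact: path_generator_squarefree.
Qed.
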